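(* Let $\mathcal{I}=\{1,\dots,m\}$ and $\mathcal{J}=\{1,\dots,n\}$ be finite nonempty index sets, let $a_{ij}\in\mathbb{R}^d$ and $b_{ij}\in\mathbb{R}$ for $i\in\mathcal{I}$, $j\in\mathcal{J}$, and let $g_i\colon\mathbb{R}^d\to\mathbb{R}$ be given by $g_i(x)=\max_{j\in\mathcal{J}}(a_{ij}^\top x+b_{ij})$. Suppose that the functions $g_i$ are nonredundant in the sense that for every $i\in\mathcal{I}$ and every $j\in\mathcal{J}$ there exists $x\in\mathbb{R}^d$ such that $g_i(x)=a_{ij}^\top x+b_{ij}$. Let $h\colon\Gamma\to\mathbb{R}$ be an arbitrary real-valued function defined on some nonempty set $\Gamma$, and let $i\in\mathcal{I}$. Then, for all $y\in\mathbb{R}^d$ and all $\gamma\in\Gamma$, it holds that $g_i^*(y)\le h(\gamma)$ if and only if, for all $j\in\mathcal{J}$, there exists $\nu_{ij}\in\mathbb{R}^n$ such that the following all hold: 1. $y=\sum_{l\in\mathcal{J}}\theta_l a_{il}$ for some $\theta\in\mathbb{R}^n$ such that $\theta\ge0$ and $\sum_{l\in\mathcal{J}}\theta_l=1$; 2. $\nu_{ij}\ge0$ (componentwise); 3. $y-a_{ij}+\sum_{l\in\mathcal{J}}(\nu_{ij})_l(a_{ij}-a_{il})=0$; 4. $-b_{ij}+\sum_{l\in\mathcal{J}}(\nu_{ij})_l(b_{ij}-b_{il})\le h(\gamma)$.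
   Context: The conjugate of a function $f\colon\mathbb{R}^d\to\overline{\mathbb{R}}=\mathbb{R}\cup\{-\infty,\infty\}$ is $f^*\colon\mathbb{R}^d\to\overline{\mathbb{R}}$, $f^*(y)=\sup_{x\in\operatorname{dom}(f)}(y^\top x-f(x))$, where $\operatorname{dom}(f)=\{x\in\mathbb{R}^d:f(x)<\infty\}$. $(\nu_{ij})_l$ denotes the $l$-th component of the vector $\nu_{ij}\in\mathbb{R}^n$. *)

(* Defs.v *)
From HB Require Import structures.
From mathcomp Require Import all_boot all_order all_algebra.
From mathcomp Require Import all_classical all_reals ereal.

Set Implicit Arguments.
Unset Strict Implicit.
Unset Printing Implicit Defensive.

Import Order.TTheory GRing.Theory Num.Theory.

Local Open Scope classical_set_scope.
Local Open Scope ring_scope.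

Definition dotv (R : realType) (d : nat) (u v : 'cV[R]_d) : R :=
  (u^T *m v) ord0 ord0.

Definition effdom (R : realType) (d : nat) (f : 'cV[R]_d -> \bar R) :
  set 'cV[R]_d := [set x | (f x < +oo)%E].

Definition conjugate (R : realType) (d : nat) (f : 'cV[R]_d -> \bar R)
  (y : 'cV[R]_d) : \bar R :=
  ereal_sup [set ((dotv y x)%:E - f x)%E | x in effdom f].

(* The maximum runs over 'I_n.+1, i.e. over a nonempty index set; its value at
   ord0 is only a harmless seed, being itself one of the terms. *)
Definition max_affine (R : realType) (d n : nat) (a : 'I_n.+1 -> 'cV[R]_d)
  (b : 'I_n.+1 -> R) (x : 'cV[R]_d) : R :=
  \big[Num.max/(dotv (a ord0) x + b ord0)]_(j < n.+1) (dotv (a j) x + b j).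

Definition nonredundant (R : realType) (d n : nat) (a : 'I_n.+1 -> 'cV[R]_d)
  (b : 'I_n.+1 -> R) : Prop :=
  forall j, exists x, max_affine a b x = dotv (a j) x + b j.

(* Main.v *)
(* Writing g for g_i, the inequality g^*(y) <= h says that y^T x - t <= h
   whenever t >= a_l^T x + b_l for all l. By Farkas' lemma this holds iff some
   convex combination theta gives y = sum theta_l a_l and
   - sum theta_l b_l <= h, and then nu_j = theta works for every j. Conversely,
   at a point x where the maximum is attained by the j-th piece, nu_j certifies
   y^T x - g(x) <= h. *)
Require Import Defs.
From HB Require Import structures.
From mathcomp Require Import all_boot all_order all_algebra.
From mathcomp Require Import all_classical all_reals ereal.
From mathcomp Require Import ring lra.

Set Implicit Arguments.
Unset Strict Implicit.
Unset Printing Implicit Defensive.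

Import Order.TTheory GRing.Theory Num.Theory.

Local Open Scope ring_scope.

Section DotProduct.
Context {R : realType} {d : nat}.
Implicit Types (u v w : 'cV[R]_d) (c : R).

Lemma dotvDl u v w : dotv (u + v) w = dotv u w + dotv v w.
Proof. by rewrite /dotv linearD mulmxDl [LHS]mxE. Qed.

Lemma dotvZl c u w : dotv (c *: u) w = c * dotv u w.
Proof. by rewrite /dotv linearZ -scalemxAl [LHS]mxE. Qed.

Lemma dotvBl u v w : dotv (u - v) w = dotv u w - dotv v w.
Proof. by rewrite -scaleN1r dotvDl dotvZl mulN1r. Qed.

Lemma dotvC u v : dotv u v = dotv v u.
Proof. by rewrite /dotv -[in RHS](trmxK u) -trmx_mul [RHS]mxE. Qed.

Lemma dotvBr u v w : dotv w (u - v) = dotv w u - dotv w v.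
Proof. by rewrite !(dotvC w) dotvBl. Qed.

Lemma dotvZr c u w : dotv w (c *: u) = c * dotv w u.
Proof. by rewrite !(dotvC w) dotvZl. Qed.

Lemma dotv0r u : dotv u 0 = 0.
Proof. by rewrite /dotv mulmx0 mxE. Qed.

Lemma dotv_suml (I : finType) (f : I -> 'cV[R]_d) w :
  dotv (\sum_i f i) w = \sum_i dotv (f i) w.
Proof. by rewrite /dotv raddf_sum mulmx_suml summxE. Qed.

Lemma dotvv_le0 u : dotv u u <= 0 -> u = 0.
Proof.
rewrite /dotv mxE => u_le0; apply/colP => k; rewrite [RHS]mxE.
have sq_ge0 l : true -> 0 <= u^T ord0 l * u l ord0.
  by rewrite mxE -expr2 sqr_ge0.
have /eqP : \sum_l u^T ord0 l * u l ord0 = 0.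
  by apply/eqP; rewrite eq_le u_le0 sumr_ge0.
rewrite psumr_eq0 // => /allP/(_ k); rewrite mem_index_enum => /(_ isT) /=.
by rewrite mxE mulf_eq0 orbb => /eqP.
Qed.

End DotProduct.

Lemma dotv_col_mx (R : realType) (p q : nat) (u x : 'cV[R]_p) (v z : 'cV[R]_q) :
  dotv (col_mx u v) (col_mx x z) = dotv u x + dotv v z.
Proof. by rewrite /dotv tr_col_mx mul_row_col [LHS]mxE. Qed.

Lemma dotv_scalar (R : realType) (r s : R) :
  dotv (r%:M : 'cV_1) (s%:M : 'cV_1) = r * s.
Proof. by rewrite /dotv tr_scalar_mx -scalar_mxM mxE eqxx mulr1n. Qed.

(* Bartl's induction: if the implication fails without the constraint v 0, a
   witness x0 of the failure has dotv (v 0) x0 > 0, and projecting along x0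
   onto the hyperplane orthogonal to v 0 eliminates v 0. *)
Lemma farkas (R : realType) (d n : nat) (v : 'I_n -> 'cV[R]_d) (w : 'cV[R]_d) :
  (forall x, (forall l, dotv (v l) x <= 0) -> dotv w x <= 0) ->
  exists2 theta : 'I_n -> R,
    forall l, 0 <= theta l & w = \sum_l theta l *: v l.
Proof.
elim: n v w => [|n IHn] v w hw.
  exists (fun=> 0) => //; rewrite big_ord0.
  by apply: dotvv_le0; apply: hw => -[].
pose v' l := v (lift ord0 l).
have [hw'|] := pselect (forall x, (forall l, dotv (v' l) x <= 0) -> dotv w x <= 0).
  have [theta theta_ge0 ->] := IHn _ _ hw'.
  exists (fun l => oapp theta 0 (unlift ord0 l)) => [l|].
    by case: (unlift ord0 l) => /=.
  rewrite big_ord_recl unlift_none /= scale0r add0r.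
  by apply: eq_bigr => l _; rewrite liftK.
move=> /existsNP[x0 /not_implyP[v'x0 /negP]]; rewrite -ltNge => wx0.
have v0x0 : 0 < dotv (v ord0) x0.
  rewrite ltNge; apply/negP => v0x0; move: wx0; rewrite ltNge => /negP; apply.
  by apply: hw => l; case: (unliftP ord0 l) => [k ->|->] //; apply: v'x0.
pose c u := dotv u x0 / dotv (v ord0) x0.
pose p u := u - c u *: v ord0.
(* [p] is the adjoint of that projection: a constraint [p (v' l)] at [x] is [v' l] at the projected
   point, where [v ord0] vanishes. *)
have pE u x : dotv (p u) x = dotv u (x - (dotv (v ord0) x / dotv (v ord0) x0) *: x0).
  by rewrite /p /c dotvBl dotvZl dotvBr dotvZr; ring.
have [theta theta_ge0 wE] : exists2 theta : 'I_n -> R,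
    forall l, 0 <= theta l & p w = \sum_l theta l *: p (v' l).
  apply: IHn => x hx; rewrite pE; apply: hw => l.
  case: (unliftP ord0 l) => [k ->|->]; first by rewrite -pE hx.
  by rewrite dotvBr dotvZr divfK ?subrr ?gt_eqF.
(* Expanding [p] in the certificate for [p w] forces this coefficient of [v ord0]. It is nonnegative
   because [w] is positive at [x0] while every [v' l] is nonpositive there. *)
pose e := c w - \sum_l theta l * c (v' l).
exists (fun l => oapp theta e (unlift ord0 l)) => [l|].
  case: (unlift ord0 l) => //=; rewrite subr_ge0.
  apply: (@le_trans _ _ 0); last by rewrite divr_ge0 // ltW.
  apply: sumr_le0 => k _; rewrite mulr_ge0_le0 //.
  by rewrite mulr_le0_ge0 ?v'x0 // invr_ge0 ltW.
rewrite big_ord_recl unlift_none /=.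
under eq_bigr do rewrite liftK /=.
rewrite [LHS](_ : w = \sum_l theta l *: p (v' l) + c w *: v ord0); last first.
  by rewrite -wE subrK.
rewrite /e scalerBl scaler_suml.
under [X in X + _ = _]eq_bigr do rewrite /p scalerBr scalerA.
by rewrite sumrB addrAC [RHS]addrAC [X in X - _ = _]addrC.
Qed.

Section MaxAffine.
Context {R : realType} {d n : nat}.
Variables (a : 'I_n.+1 -> 'cV[R]_d) (b : 'I_n.+1 -> R).

Lemma max_affine_ge x j : dotv (a j) x + b j <= max_affine a b x.
Proof. exact: le_bigmax. Qed.

Lemma max_affine_le x t :
  (forall j, dotv (a j) x + b j <= t) -> max_affine a b x <= t.
Proof. by move=> ht; apply: bigmax_le. Qed.

Lemma max_affine_attained x : exists j, max_affine a b x = dotv (a j) x + b j.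
Proof.
apply: contrapT => /forallNP hx; have : max_affine a b x < max_affine a b x.
  (* The seed of the maximum is the term at [ord0], so the same argument bounds seed and terms
     strictly. *)
  apply: bigmax_lt => [|j _]; rewrite lt_neqAle max_affine_ge andbT;
    by apply/eqP => /esym/hx.
by rewrite ltxx.
Qed.

(** Farkas' lemma is homogeneous, so two coordinates are added to [x]: [s] plays the role of [- t]
    and [r] is a scale multiplying the constants [b l] and [c]. *)
Lemma conjugate_affine_cert (y : 'cV[R]_d) (c : R) :
  (forall x, dotv y x - max_affine a b x <= c) ->
  exists theta : 'I_n.+1 -> R,
    [/\ forall l, 0 <= theta l, \sum_l theta l = 1,
        y = \sum_l theta l *: a l & - \sum_l theta l * b l <= c].
Proof.
move=> hy.
pose vec (u : 'cV[R]_d) (s t : R) : 'cV[R]_(d + (1 + 1)) :=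
  col_mx u (col_mx s%:M t%:M).
have vecE u s t x r q :
    dotv (vec u s t) (vec x r q) = dotv u x + (s * r + t * q).
  by rewrite !dotv_col_mx !dotv_scalar.
(* Index [ord0] encodes [0 <= r]; the others encode the homogenized pieces
   [dotv (a l) x + s + b l * r <= 0]. *)
pose v k := oapp (fun l => vec (a l) 1 (b l)) (vec 0 0 (-1)) (unlift ord0 k).
have [theta theta_ge0 wE] : exists2 theta : 'I_n.+2 -> R,
    forall l, 0 <= theta l & vec y 1 (- c) = \sum_l theta l *: v l.
  apply: farkas => z.
  have -> : z = vec (usubmx z) (usubmx (dsubmx z) ord0 ord0)
                    (dsubmx (dsubmx z) ord0 ord0).
    by rewrite /vec -!mx11_scalar !vsubmxK.
  move: (usubmx z) (usubmx _ _ _) (dsubmx _ _ _) => x s r hv.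
  have r_ge0 : 0 <= r.
    have := hv ord0; rewrite /v unlift_none vecE dotvC dotv0r; lra.
  have av l : dotv (a l) x + s + b l * r <= 0.
    by have := hv (lift ord0 l); rewrite /v liftK vecE; lra.
  rewrite vecE mul1r leNgt; apply/negP => wx.
  have [r0|r_neq0] := eqVneq r 0.
    (* A recession direction: y^T (lam x) - g (lam x) grows at least like lam * e. *)
    pose e := dotv y x + s.
    have e_gt0 : 0 < e by move: wx; rewrite r0 /e; lra.
    (* Chosen so that [lam * e] exceeds [c + max_affine a b 0], which contradicts [hy] at
       [lam *: x]. *)
    pose lam := (`|c + max_affine a b 0| + 1) / e.
    have lam_ge0 : 0 <= lam by rewrite divr_ge0 ?(ltW e_gt0) ?addr_ge0.
    have glam : max_affine a b (lam *: x) <= max_affine a b 0 - lam * s.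
      apply: max_affine_le => l; rewrite dotvZr.
      have := max_affine_ge 0 l; rewrite dotv0r => bl.
      have := av l; rewrite r0 => al.
      have : lam * (dotv (a l) x + s) <= 0 by apply: mulr_ge0_le0 => //; lra.
      lra.
    have := hy (lam *: x); rewrite dotvZr => hlam.
    have lamE : lam * e = `|c + max_affine a b 0| + 1 by rewrite divfK ?gt_eqF.
    have := ler_norm (c + max_affine a b 0); rewrite /e in lamE; lra.
  (* For positive [r], dividing by [r] undoes the homogenization, and [hy] at [r^-1 *: x]
     contradicts [wx]. *)
  have r_gt0 : 0 < r by rewrite lt_neqAle eq_sym r_neq0.
  have gx : max_affine a b (r^-1 *: x) <= - (r^-1 * s).
    apply: max_affine_le => l; rewrite dotvZr.
    have : r^-1 * (dotv (a l) x + s + b l * r) <= 0.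
      by rewrite mulr_ge0_le0 ?invr_ge0.
    by rewrite !mulrDr mulrCA mulVf //; lra.
  have := hy (r^-1 *: x); rewrite dotvZr => hx.
  have : 0 < r^-1 * (dotv y x + (s + - c * r)) by rewrite mulr_gt0 ?invr_gt0.
  by rewrite !mulrDr mulrCA mulVf //; lra.
(* The Farkas identity paired with an arbitrary [(x, s, r)]; unit vectors in [s] and [r] then read
   off the last two coordinates. *)
have dual x s r : dotv y x + (s - c * r) = - (theta ord0 * r) +
    \sum_l theta (lift ord0 l) * (dotv (a l) x + (s + b l * r)).
  have := congr1 (fun u => dotv u (vec x s r)) wE.
  rewrite vecE dotv_suml big_ord_recl dotvZl /v unlift_none vecE (dotvC 0) dotv0r.
  under eq_bigr do rewrite dotvZl liftK vecE mul1r.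
  by move=> /= E; rewrite mul1r mulNr in E; rewrite E; congr (_ + _); ring.
exists (theta \o lift ord0); split => /=.
- by move=> l; apply: theta_ge0.
- have := dual 0 1 0; rewrite !(dotv0r, mulr0, subr0, oppr0, add0r) => ->.
  by apply: eq_bigr => l _; rewrite dotv0r mulr0 addr0 add0r mulr1.
- have /(congr1 usubmx) := wE; rewrite col_mxKu big_ord_recl raddfD raddf_sum /=.
  rewrite /v unlift_none linearZ /= col_mxKu scaler0 add0r => ->.
  by apply: eq_bigr => l _; rewrite liftK linearZ /= col_mxKu.
(* The multiplier [theta ord0] of [0 <= r] is the slack in the bound by [c]. *)
- have -> : \sum_l theta (lift ord0 l) * b l = theta ord0 - c.
    have := dual 0 0 1; rewrite dotv0r !mulr1 !add0r => ->; rewrite addrA subrr add0r.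
    by apply: eq_bigr => l _; rewrite dotv0r mulr1 !add0r.
  by have := theta_ge0 ord0; lra.
Qed.

End MaxAffine.

Lemma conjugate_le (R : realType) (d : nat) (g : 'cV[R]_d -> R) (y : 'cV[R]_d) (c : R) :
  (conjugate (fun x => (g x)%:E) y <= c%:E)%E <->
  forall x, dotv y x - g x <= c.
Proof.
split=> [hc x|hx].
  rewrite -lee_fin; apply: le_trans hc.
  by apply: ereal_sup_ubound; exists x => //; rewrite /effdom /= ltry.
by apply: ge_ereal_sup => _ [x _ <-]; rewrite -EFinB lee_fin.
Qed.

Theorem theorem3 (R : realType) (d m n : nat)
    (a : 'I_m.+1 -> 'I_n.+1 -> 'cV[R]_d) (b : 'I_m.+1 -> 'I_n.+1 -> R)
    (g_nonredundant : forall i : 'I_m.+1, nonredundant (a i) (b i))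
    (Gamma : Type) (Gamma_nonempty : inhabited Gamma) (h : Gamma -> R)
    (i : 'I_m.+1) (y : 'cV[R]_d) (gamma : Gamma) :
  (conjugate (fun x => (max_affine (a i) (b i) x)%:E) y <= (h gamma)%:E)%E
  <->
  forall j : 'I_n.+1, exists nu : 'cV[R]_n.+1,
    [/\ exists theta : 'cV[R]_n.+1,
          [/\ y = \sum_(l < n.+1) theta l ord0 *: a i l,
              forall l, 0 <= theta l ord0
            & \sum_(l < n.+1) theta l ord0 = 1],
        forall l, 0 <= nu l ord0,
        y - a i j + \sum_(l < n.+1) nu l ord0 *: (a i j - a i l) = 0
      & - b i j + \sum_(l < n.+1) nu l ord0 * (b i j - b i l) <= h gamma].
Proof.
rewrite conjugate_le; split=> [/conjugate_affine_cert|hnu x].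
  move=> [theta [theta_ge0 theta1 yE yb]] j; exists (\col_l theta l); split.
  - exists (\col_l theta l); split=> [|l|]; last 2 first.
    + by rewrite mxE.
    + by under eq_bigr do rewrite mxE.
    by rewrite yE; apply: eq_bigr => l _; rewrite mxE.
  - by move=> l; rewrite mxE.
  (* As the weights sum to one, the [a i j] terms cancel and [y] minus the convex combination
     remains; likewise for [b] below. *)
  - under eq_bigr do rewrite mxE scalerBr.
    by rewrite sumrB -scaler_suml theta1 scale1r -yE addrA subrK subrr.
  - under eq_bigr do rewrite mxE mulrBr.
    by rewrite sumrB -mulr_suml theta1 mul1r addrA addNr add0r.
have [j gx] := max_affine_attained (a i) (b i) x.
have [nu [_ nu_ge0 nua nub]] := hnu j; apply: le_trans nub.
have : dotv y x - dotv (a i j) x +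
    \sum_l nu l ord0 * (dotv (a i j) x - dotv (a i l) x) = 0.
  have := congr1 (fun u => dotv u x) nua.
  rewrite dotvDl dotv_suml dotvBl (dotvC 0) dotv0r => E; rewrite -[RHS]E; congr (_ + _).
  by apply: eq_bigr => l _; rewrite dotvZl dotvBl.
(* Piece [j] is maximal at [x], so each difference between piece [j] and piece [l] is nonnegative
   there, and so is their sum weighted by [nu]. *)
have : 0 <= \sum_l nu l ord0 * (dotv (a i j) x - dotv (a i l) x) +
            \sum_l nu l ord0 * (b i j - b i l).
  rewrite -big_split sumr_ge0 //= => l _; rewrite -mulrDr mulr_ge0 //.
  by have := max_affine_ge (a i) (b i) x l; rewrite gx; lra.
by rewrite gx; lra.
Qed.
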